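(* Let $p>0$, $q>0$ and $m\in\mathbb{N}$. Let $\mathbf{b}=(b_k)_{k\in\mathbb{N}}\subset\mathbb{C}$ be a sequence such that $$\lim_{n\to\infty}\frac{1}{n^p}\sum_{k=1}^n b_k=b\in\mathbb{C},$$ and suppose that there is a finite constant $B$ with $$\frac{1}{n^p}\sum_{k=1}^n|b_k|\leq B\qquad\text{for all } n\in\mathbb{N}.$$ Let $(a_{k_1,\ldots,k_m})_{k_1,\ldots,k_m\in\mathbb{N}}\subset\mathbb{C}$ be a multi-indices sequence such that $$\lim_{n\to\infty}\frac{1}{n^{q}}\sum_{1\leq k_1,\ldots,k_m\leq n}a_{k_1,\ldots,k_m}=a\in\mathbb{C}.$$ Suppose in addition that $$a_{k_1-h,\ldots,k_m-h}=a_{k_1,\ldots,k_m}$$ for all $k_1,\ldots,k_m\in\mathbb{N}$ and all $h\in\mathbb{N}$ with $h<\min\{k_1,\ldots,k_m\}$. Then $$\lim_{n\to\infty}\frac{1}{n^{p+q}}\sum_{k=1}^n b_k\sum_{k+1\leq k_1,\ldots,k_m\leq n}a_{k_1,\ldots,k_m}=ab\,\frac{\Gamma(p+1)\Gamma(q+1)}{\Gamma(p+q+1)}.$$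
   Context: $\mathbb{N}=\{1,2,3,\dots\}$. The notation $\sum_{r\leq k_1,\ldots,k_m\leq n}$ means the sum over all $m$-tuples $(k_1,\dots,k_m)$ of natural numbers with $r\le k_i\le n$ for each $i=1,\dots,m$; it is an empty sum, equal to $0$, if $r>n$. $\Gamma$ is Euler's Gamma function. *)

(* Defs.v *)
From HB Require Import structures.
From mathcomp Require Import all_boot all_order all_algebra.
From mathcomp Require Import all_classical all_reals all_analysis.
From mathcomp Require Import complex.

Set Implicit Arguments.
Unset Strict Implicit.
Unset Printing Implicit Defensive.

Import Order.TTheory GRing.Theory Num.Theory.
Import numFieldNormedType.Exports.

Local Open Scope classical_set_scope.
Local Open Scope ring_scope.
Local Open Scope complex_scope.

(* Euler's Gamma function for s > 0; for s <= 0 the integral diverges and the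
   value is meaningless. *)
Definition Gamma (R : realType) (s : R) : R :=
  \int[@lebesgue_measure R]_(x in `]0, +oo[) (x `^ (s - 1) * expR (- x)).

(* \sum_(r <= k_1, ..., k_m <= n) a_(k_1, ..., k_m): the upper bound n is
   carried by 'I_n.+1. For m > 0 the sum is empty when n < r. *)
Definition multisum (V : nmodType) (m r n : nat)
    (a : {ffun 'I_m -> nat} -> V) : V :=
  \sum_(k : {ffun 'I_m -> 'I_n.+1} | [forall i, (r <= k i)%N])
     a [ffun i => nat_of_ord (k i)].

(* Main.v *)
Require Import Defs.
From HB Require Import structures.
From mathcomp Require Import all_boot all_order all_algebra.
From mathcomp Require Import all_classical all_reals all_analysis.
From mathcomp Require Import complex.
From mathcomp Require Import measurable_realfun ring lra.

(** Write [P n = n^p], [Q n = n^q], and let [V n] be the sum of [a] over the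
    cube [1..n]^m. Shift invariance turns the inner sum over the cube
    [k+1..n]^m into [V (n - k)] ([multisum_shift]), so the quantity to study is
    the convolution [sum_k b_k V_(n-k)], divided by [P n * Q n].

    _Abelian part_ ([cvg_convol_compare]). Replacing [V] by [a Q] costs
    [o(P Q)], because the partial sums of [|b_k|] are [O(P)]. Summation by parts
    then moves the partial summation from the increments of [Q] to [b], and
    replacing the partial sums of [b] by [b P] costs [o(P Q)] again, because the
    increments of [Q] are nonnegative. Hence, up to [o(1)], the normalised
    convolution is [a * b] times a number [W n] which depends on [p], [q] and
    [n] only ([a] and [b] also denote the two limits).

    _The constant_ ([cvg_convol_powR]). [W n] is a Riemann-Stieltjes sum of
    a Beta integral, but its limit can be found without integrating: the Abelian
    part holds for every admissible pair of sequences, so it is enough to know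
    one pair whose convolution is explicit. The coefficients
    [multichoose x n = x (x+1) ... (x+n-1) / n!] of [(1 - z)^(-x)] form such a
    family: the convolution of those of [x] and [y] is that of [x + y]
    ([multichooseD]), and [multichoose (s + 1) n ~ n^s / Gamma (s + 1)]
    ([cvg_multichoose]). The pair [p], [q + 1] gives
      [lim W / (Gamma (p + 1) Gamma (q + 1)) = 1 / Gamma (p + q + 1)].

    _The Gamma asymptotics_ combine the functional equation ([Gamma_succ]) with
    the inequality [Gamma (x + s) <= (x + s)^s Gamma x] ([Gamma_shift_le]), the
    integrated form of a tangent line bound for the convex function
    [t |-> t^(-s)]. Taken with shift [s] from [n + 1], and with shift [N - s]
    from [n + s + 1] for an integer [N >= s], it squeezes
    [Gamma (n + s + 1) / (n! n^s)] to 1. *)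

Set Implicit Arguments.
Unset Strict Implicit.
Unset Printing Implicit Defensive.

Import Order.TTheory GRing.Theory Num.Theory.
Import numFieldNormedType.Exports.

Local Open Scope classical_set_scope.
Local Open Scope ring_scope.
Local Open Scope complex_scope.

(** * Convolutions of sequences with regular partial sums *)

Section AbelianConvolution.
Context {K : numFieldType}.
Implicit Types (u v e P Q : nat -> K) (a b B : K).

Definition psum u n := \sum_(k < n.+1) u k.
Definition convol u v n := \sum_(k < n.+1) u k * v (n - k)%N.
Definition increments u n := if n is n'.+1 then u n'.+1 - u n' else u 0%N.

Lemma psum_increments u n : psum (increments u) n = u n.
Proof.
elim: n => [|n IH]; first by rewrite /psum big_ord1.
by rewrite /psum big_ord_recr/= -/(psum _ n) IH addrC subrK.
Qed.

(** Summation by parts: both sides sum [u i * v j] over the triangle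
    [i + j <= n]. *)
Lemma convol_psumC u v n : convol u (psum v) n = convol v (psum u) n.
Proof.
have E w z : convol w (psum z) n =
    \sum_(i < n.+1) \sum_(j < n.+1) if (i + j <= n)%N then w i * z j else 0.
  apply: eq_bigr => i _; rewrite -big_mkcond/= -big_distrr/=; congr (_ * _).
  rewrite /psum.
  rewrite (big_ord_widen _ z (_ : (n - i).+1 <= n.+1)%N) ?ltnS ?leq_subr//.
  by apply: eq_bigl => j; rewrite ltnS leq_subRL ?leq_ord.
rewrite !E exchange_big/=; apply: eq_bigr => j _; apply: eq_bigr => i _.
by rewrite addnC mulrC.
Qed.

(** The weights by which sequences are normalised. The value at 0 is only
    required to be nonnegative, since it is 0 for [n^p]. *)
Definition growth P := [/\ 0 <= P 0%N, forall n, 0 < P n.+1,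
  forall n, P n <= P n.+1 & (P n)^-1 @[n --> \oo] --> (0 : K)].

Lemma growth_le P : growth P -> {homo P : i j / (i <= j)%N >-> i <= j}.
Proof. by case=> _ _ Pm _; apply: homo_leq => // x y z; exact: le_trans. Qed.

Lemma growth_sum_increments P n : growth P ->
  psum (fun k => `|increments P k|) n = P n.
Proof.
case=> P0 _ Pm _; rewrite -[RHS]psum_increments.
apply: eq_bigr => -[[|k] hk] _ /=.
  by rewrite ger0_norm.
by rewrite ger0_norm// subr_ge0.
Qed.

(** For every [d > 0] there is a constant [C] with [|e j| <= d * Q n + C] for
    all [j <= n]; hence the convolution is at most [B * P n * (d * Q n + C)],
    and [C] is negligible against [Q n]. *)
Lemma cvg_convol0 u e P Q B : growth P -> growth Q ->
  (forall n, psum (fun k => `|u k|) n.+1 <= B * P n.+1) ->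
  e n / Q n @[n --> \oo] --> (0 : K) ->
  convol u e n / (P n * Q n) @[n --> \oo] --> (0 : K).
Proof.
move=> gP gQ uB eQ; have Qle := growth_le gQ.
case: gP gQ => _ P0 _ _ [Q00 Q0 _ QV].
have B0 : 0 <= B.
  rewrite -(pmulr_lge0 _ (P0 0%N)); apply: le_trans (uB 0%N).
  exact: sumr_ge0.
have B1 : 0 < B + 1 by rewrite ltr_pwDr.
apply/cvgr0Pnorm_lt => eps eps0.
(* [B] may vanish, hence the denominator [B + 1]. *)
pose d := eps / 2 / (B + 1).
have d0 : 0 < d by rewrite !divr_gt0.
have [N _ HN] := (cvgr0Pnorm_lt _).1 eQ d d0.
pose C := \sum_(j < N.+1) `|e j|.
have C0 : 0 <= C by exact: sumr_ge0.
have eC n j : (j <= n)%N -> `|e j| <= d * Q n + C.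
  move=> jn; have Qn0 : 0 <= Q n by apply: le_trans Q00 (Qle _ _ (leq0n _)).
  have [jN|Nj] := leqP j N.
    rewrite -[leLHS]add0r; apply: lerD; first by rewrite mulr_ge0// ltW.
    rewrite /C (bigD1 (Ordinal (jN : (j < N.+1)%N)))//= lerDl.
    exact: sumr_ge0.
  rewrite -[leLHS]addr0; apply: lerD => //.
  case: j jn Nj => // j jn Nj.
  have := HN j.+1 (ltnW Nj).
  rewrite /= normf_div [X in _ / X]gtr0_norm// ltr_pdivrMr// => /ltW /le_trans.
  apply.
  by rewrite ler_pM2l// Qle.
have key : forall n, `|convol u e n.+1 / (P n.+1 * Q n.+1)| <=
    B * d + B * C * (Q n.+1)^-1.
  move=> n; have PQ0 : 0 < P n.+1 * Q n.+1 by rewrite mulr_gt0.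
  rewrite normf_div (gtr0_norm PQ0) ler_pdivrMr//.
  have -> : (B * d + B * C / Q n.+1) * (P n.+1 * Q n.+1) =
      B * P n.+1 * (d * Q n.+1 + C).
    by field; rewrite gt_eqF.
  apply: le_trans (ler_norm_sum _ _ _) _.
  apply: (@le_trans _ _ (psum (fun k => `|u k|) n.+1 * (d * Q n.+1 + C))).
    rewrite /psum mulr_suml; apply: ler_sum => k _.
    by rewrite normrM ler_wpM2l// eC// leq_subr.
  by rewrite ler_wpM2r// addr_ge0// mulr_ge0 ?ltW.
have e20 : 0 < eps / 2 by rewrite divr_gt0.
have : B * C * (Q n)^-1 @[n --> \oo] --> (0 : K).
  by rewrite -[X in _ --> X](mulr0 (B * C)); apply: cvgM => //; exact: cvg_cst.
move=> /cvgr0Pnorm_lt /(_ _ e20) [M _ HM].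
exists M.+1 => // -[//|n] /= Mn.
apply: le_lt_trans (key n) _.
have := HM n.+1 (ltnW Mn); rewrite /= ger0_norm; last first.
  by rewrite !mulr_ge0// invr_ge0 ltW.
move=> h; rewrite [ltRHS](splitr eps) ler_ltD//.
by rewrite /d mulrCA ger_pMr// ler_pdivrMr// mul1r lerDl.
Qed.

Lemma cvg_sub_scale0 v Q a : growth Q -> v n / Q n @[n --> \oo] --> a ->
  (v n - a * Q n) / Q n @[n --> \oo] --> (0 : K).
Proof.
case=> _ Q0 _ _ h.
have h1 : (v n / Q n - a) @[n --> \oo] --> (0 : K).
  by rewrite -(subrr a); apply: cvgB => //; exact: cvg_cst.
apply: cvg_trans h1; apply: near_eq_cvg; exists 1%N => // -[//|n] _ /=.
by rewrite mulrBl mulfK// gt_eqF.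
Qed.

(** [convol u v] differs from [a * convol u Q] by [convol u (v - a Q)]. By
    [convol_psumC] the latter is [a * convol (increments Q) (psum u)], which
    differs from [a * b * convol (increments Q) P] by a convolution with
    [psum u - b P]. Both errors fall under [cvg_convol0], the second one with
    [P] and [Q] exchanged. *)
Lemma cvg_convol_compare u v P Q a b B : growth P -> growth Q ->
  (forall n, psum (fun k => `|u k|) n.+1 <= B * P n.+1) ->
  psum u n / P n @[n --> \oo] --> b ->
  v n / Q n @[n --> \oo] --> a ->
  convol u v n / (P n * Q n) -
    a * b * (convol (increments Q) P n / (P n * Q n)) @[n --> \oo] --> (0 : K).
Proof.
move=> gP gQ uB ub va.
have h1 := cvg_convol0 gP gQ uB (cvg_sub_scale0 gQ va).
have iQ n : psum (fun k => `|increments Q k|) n.+1 <= 1 * Q n.+1.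
  by rewrite growth_sum_increments// mul1r.
have h2 := cvg_convol0 gQ gP iQ (cvg_sub_scale0 gP ub).
have h3 : (convol u (fun n => v n - a * Q n) n / (P n * Q n) +
    a * (convol (increments Q) (fun n => psum u n - b * P n) n / (Q n * P n)))
    @[n --> \oo] --> (0 : K).
  have -> : 0 = 0 + a * 0 :> K by rewrite mulr0 addr0.
  by apply: cvgD => //; apply: cvgM => //; exact: cvg_cst.
apply: cvg_trans h3; apply: near_eq_cvg; near=> n.
have lin w z x c :
    convol w (fun n => z n - c * x n) n = convol w z n - c * convol w x n.
  rewrite /convol big_distrr -sumrB/=; apply: eq_bigr => k _; ring.
have -> : convol u (fun n => v n - a * Q n) n =
    convol u v n - a * convol (increments Q) (psum u) n.
  rewrite lin -convol_psumC; congr (_ - _ * _); apply: eq_bigr => k _.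
  by rewrite psum_increments.
rewrite /= lin [Q n * P n]mulrC; ring.
Unshelve. all: by end_near. Qed.

Lemma cvg_convol u v P Q a b B l : growth P -> growth Q ->
  (forall n, psum (fun k => `|u k|) n.+1 <= B * P n.+1) ->
  psum u n / P n @[n --> \oo] --> b ->
  v n / Q n @[n --> \oo] --> a ->
  convol (increments Q) P n / (P n * Q n) @[n --> \oo] --> l ->
  convol u v n / (P n * Q n) @[n --> \oo] --> a * b * l.
Proof.
move=> gP gQ uB ub va Wl; have h := cvg_convol_compare gP gQ uB ub va.
pose W n := convol (increments Q) P n / (P n * Q n).
have h2 : (convol u v n / (P n * Q n) - a * b * W n + a * b * W n)
    @[n --> \oo] --> a * b * l.
  rewrite -[X in _ --> X]add0r; apply: cvgD; first exact: h.
  by apply: cvgM; [exact: cvg_cst|exact: Wl].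
apply: cvg_trans h2; apply: near_eq_cvg; near=> n.
by rewrite subrK.
Unshelve. all: by end_near. Qed.

End AbelianConvolution.

(** * The Gamma integral *)

Section GammaIntegral.
Context {R : realType}.
Implicit Types s x : R.
Local Notation mu := (@lebesgue_measure R).
Local Notation halfline := (`[0%R, +oo[%classic : set R).

(** Apply [y <= expR y] at [y = x / (2 (s + 1))] and raise it to the power [s];
    the [s + 1] avoids a division by 0 when [s = 0]. *)
Lemma powR_le_expR_half s : 0 <= s ->
  exists2 C : R, 0 < C & forall x, 0 <= x -> x `^ s <= C * expR (x / 2).
Proof.
move=> s0; exists ((2 * (s + 1)) `^ s); first by rewrite powR_gt0//; lra.
move=> x x0.
have d0 : 0 <= x / (2 * (s + 1)) by rewrite divr_ge0//; lra.
have -> : x `^ s = (2 * (s + 1)) `^ s * (x / (2 * (s + 1))) `^ s.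
  by rewrite -powRM//; [congr (_ `^ _); field; lra|lra].
rewrite ler_wpM2l ?powR_ge0//.
apply: (@le_trans _ _ (expR (x / (2 * (s + 1))) `^ s)).
  rewrite ge0_ler_powR// ?nnegrE ?expR_ge0//.
  by apply: le_trans (expR_ge1Dx _); lra.
rewrite -expRM ler_expR.
have -> : x / 2 = x / (2 * (s + 1)) * (s + 1) by field; lra.
by rewrite ler_wpM2l//; lra.
Qed.

Definition gamma_integrand s x : R := x `^ s * expR (- x).

Let expRN_half x : expR (x / 2) * expR (- x) = expR (- (x / 2)).
Proof. by rewrite -expRD; congr expR; lra. Qed.

Lemma gamma_integrand_le s : 0 <= s -> exists2 C : R, 0 < C &
  forall x, 0 <= x -> gamma_integrand s x <= C * expR (- (x / 2)).
Proof.
move=> /powR_le_expR_half[C C0 CP]; exists C => // x x0.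
rewrite /gamma_integrand -expRN_half mulrA.
by rewrite ler_wpM2r ?expR_ge0// CP.
Qed.

Lemma gamma_integrand_ge0 s x : 0 <= gamma_integrand s x.
Proof. by rewrite mulr_ge0 ?powR_ge0 ?expR_ge0. Qed.

Lemma measurable_gamma_integrand s : measurable_fun setT (gamma_integrand s).
Proof.
apply: measurable_funM; first exact: measurable_powR.
by apply: measurableT_comp => //; exact: measurable_expR.
Qed.

Let cvgN_half : expR (- (x / 2)) @[x --> +oo] --> (0 : R).
Proof.
rewrite (_ : (fun x : R => expR (- (x / 2))) =
             (fun z => expR (- z)) \o (fun z => 2^-1 * z)); last first.
  by apply: eq_fun => x /=; rewrite mulrC.
apply: (@cvg_comp _ _ _ _ _ _ (pinfty_nbhs R)); last exact: cvgr_expR.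
by apply: gt0_cvgMry => //; rewrite invr_gt0.
Qed.

Let is_derive_half x :
  is_derive x 1 (fun x => expR (- (x / 2)) : R) (- (2^-1 * expR (- (x / 2)))).
Proof.
have h : is_derive x 1 (fun x => - (x / 2) : R) (- 2^-1).
  rewrite (_ : (fun x => - (x / 2) : R) = (fun x => (- 2^-1) *: x)); last first.
    by apply: eq_fun => y; rewrite /GRing.scale/=; lra.
  by apply: is_derive_eq; rewrite /GRing.scale/= mulr1.
rewrite (_ : - (2^-1 * _) = expR (- (x / 2)) * (- 2^-1)); last by lra.
exact: (@is_derive1_comp _ expR (fun x => - (x / 2))).
Qed.

Let is_derive_Nhalf (C x : R) : is_derive x 1
  (fun x => - (2 * C * expR (- (x / 2))) : R) (C * expR (- (x / 2))).
Proof.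
have -> : (fun x => - (2 * C * expR (- (x / 2))) : R) =
    (- (2 * C)) *: (fun x => expR (- (x / 2)) : R).
  by apply: funext => y; rewrite /GRing.scale/= -mulNr.
have -> : C * expR (- (x / 2)) = (- (2 * C)) *: (- (2^-1 * expR (- (x / 2)))).
  by rewrite /GRing.scale/=; lra.
exact: is_deriveZ.
Qed.

Let continuous_half : continuous (fun x => expR (- (x / 2)) : R).
Proof.
move=> x.
apply: (@differentiable_continuous _ _ _ x (fun x => expR (- (x / 2)) : R)).
by apply/derivable1_diffP; apply: ex_derive.
Qed.

Lemma integrable_scale (k : R) (f : R -> R) :
  mu.-integrable halfline (EFin \o f) ->
  mu.-integrable halfline (EFin \o (fun x => k * f x)).
Proof. by move=> If; apply: (integrableZl _ k If). Qed.

Lemma integrable_sub (f g : R -> R) :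
  mu.-integrable halfline (EFin \o f) -> mu.-integrable halfline (EFin \o g) ->
  mu.-integrable halfline (EFin \o (fun x => f x - g x)).
Proof. by move=> If Ig; apply: (integrableB _ If Ig). Qed.

Lemma integral_expR_half (C : R) : 0 <= C ->
  (\int[mu]_(x in halfline) (C * expR (- (x / 2)))%:E = (2 * C)%:E)%E.
Proof.
move=> C0; rewrite (@ge0_continuous_FTC2y _ _
  (fun x => - (2 * C * expR (- (x / 2)))) _ 0)//.
- by rewrite -EFinB mul0r oppr0 expR0 mulr1 opprK add0r.
- by move=> x _; rewrite mulr_ge0// expR_ge0.
- apply: continuous_subspaceT => x; apply: cvgM; first exact: cvg_cst.
  exact: continuous_half.
- rewrite -oppr0; apply: cvgN; rewrite -(mulr0 (2 * C)).
  by apply: cvgM => //; exact: cvg_cst.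
- apply: cvg_at_right_filter; apply: cvgN; apply: cvgM; first exact: cvg_cst.
  exact: continuous_half.
- by move=> x _; rewrite derive1E; case: (is_derive_Nhalf C x).
Qed.

Lemma integrable_expR_half (C : R) : 0 <= C ->
  mu.-integrable halfline (EFin \o (fun x => C * expR (- (x / 2)))).
Proof.
move=> C0; apply/integrableP; split.
  apply/measurable_EFinP; apply: measurable_funM => //.
  apply: measurableT_comp; first exact: measurable_expR.
  apply: measurableT_comp => //; apply: measurable_funM => //.
under eq_integral do rewrite /= ger0_norm ?mulr_ge0 ?expR_ge0//.
by rewrite integral_expR_half// ltry.
Qed.

Lemma integrable_gamma_integrand s : 0 <= s ->
  mu.-integrable halfline (EFin \o gamma_integrand s).
Proof.
move=> /gamma_integrand_le[C C0 CP].
apply: (le_integrable _ _ _ (integrable_expR_half (ltW C0))) => //.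
  apply/measurable_EFinP.
  by apply: measurable_funTS; exact: measurable_gamma_integrand.
move=> x /=; rewrite in_itv/= andbT => x0; rewrite lee_fin.
rewrite !ger0_norm ?gamma_integrand_ge0 ?mulr_ge0 ?expR_ge0 ?CP// ltW//.
Qed.

(** Only arguments at least 1 occur below; there the integrand is continuous
    at 0 and the endpoint can be included. *)
Lemma GammaE s : 0 <= s ->
  Gamma (s + 1) = (\int[mu]_(x in halfline) gamma_integrand s x)%R.
Proof.
move=> s0; rewrite /Gamma addrK -Rintegral_itv_obnd_cbnd//.
apply: (integrableS _ _ _ (integrable_gamma_integrand s0)) => //.
by move=> x /=; rewrite !in_itv/= !andbT => /ltW.
Qed.

Lemma cvg_gamma_integrand s : 0 <= s -> gamma_integrand s x @[x --> +oo] --> 0.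
Proof.
move=> /gamma_integrand_le[C C0 CP].
apply: (@squeeze_cvgr _ _ _ _ (fun=> 0) (fun x => C * expR (- (x / 2)))).
- near=> x; rewrite gamma_integrand_ge0 CP//.
- exact: cvg_cst.
- rewrite -(mulr0 C); apply: cvgM => //; exact: cvg_cst.
Unshelve. all: by end_near. Qed.

Lemma is_derive_gamma_integrand s x : 0 < x ->
  is_derive x 1 (gamma_integrand s)
    (s * gamma_integrand (s - 1) x - gamma_integrand s x).
Proof.
move=> x0.
have h1 := is_derive1_powR s x0.
have h2 : is_derive x 1 (fun x => expR (- x)) (- expR (- x)).
  rewrite -[X in is_derive _ _ _ X]mulrN1.
  apply: (@is_derive1_comp _ expR (fun x => - x)).
rewrite [X in is_derive _ _ X _](_ : _ =
  (fun x : R => x `^ s) * (fun x : R => expR (- x)))//.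
apply: is_derive_eq.
by rewrite /gamma_integrand /GRing.scale/=; ring.
Qed.

Lemma cvg0_gamma_integrand s : 0 <= s ->
  gamma_integrand s x @[x --> 0^'+] --> gamma_integrand s 0.
Proof.
move=> s0; apply: cvgM; last first.
  apply: cvg_at_right_filter; apply: continuous_comp.
    exact: opp_continuous.
  exact: continuous_expR.
have [->|sn0] := eqVneq s 0.
  rewrite powRr0; under eq_fun do rewrite powRr0; exact: cvg_cst.
by rewrite powR0//; apply: powR_cvg0; rewrite lt_neqAle eq_sym sn0.
Qed.

Lemma continuous_gamma_integrand s : 0 <= s ->
  {within halfline, continuous (gamma_integrand s)}.
Proof.
move=> s0; apply/continuous_within_itvcyP.
split; last exact: cvg0_gamma_integrand.
move=> x; rewrite in_itv/= andbT => x0.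
apply: differentiable_continuous; apply/derivable1_diffP; apply: ex_derive.
exact: is_derive_gamma_integrand.
Qed.

Lemma Gamma1 : Gamma 1 = 1 :> R.
Proof.
rewrite -[1 in LHS]add0r GammaE//.
rewrite (@Rintegral_ge0_continuous_FTC2y _ _ (- gamma_integrand 0) _ 0)//.
- by rewrite [X in _ - X](_ : _ = - gamma_integrand 0 0)// /gamma_integrand
    powRr0 oppr0 expR0; lra.
- by move=> x _; exact: gamma_integrand_ge0.
- exact: continuous_gamma_integrand.
- by rewrite -oppr0; apply: cvgN; exact: cvg_gamma_integrand.
- by move=> x x0; apply: derivableN; case: (is_derive_gamma_integrand 0 x0).
- by apply: cvgN; exact: cvg0_gamma_integrand.
- move=> x; rewrite in_itv/= andbT derive1E => x0.
  have d := is_derive_gamma_integrand 0 x0.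
  by rewrite deriveN// derive_val mul0r sub0r opprK.
Qed.

(** The antiderivative of [x^(s+1) e^(-x) - (s + 1) x^s e^(-x)] is
    [- x^(s+1) e^(-x)], which vanishes at both ends of the half-line. This
    integrand changes sign; a multiple of [e^(-x/2)] dominating its negative part
    is added, so that the fundamental theorem applies to a nonnegative function,
    and the integral of this multiple is subtracted afterwards. *)
Lemma Gamma_succ s : 0 <= s -> Gamma (s + 1 + 1) = (s + 1) * Gamma (s + 1).
Proof.
move=> s0'.
have s1 : 0 <= s + 1 by lra.
have [C C0 CP] := gamma_integrand_le s0'.
pose K := (s + 1) * C.
have K0 : 0 <= K by rewrite mulr_ge0// ltW.
have I1 := integrable_gamma_integrand s1.
have I2 := integrable_gamma_integrand s0'.
have I3 := integrable_expR_half K0.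
have I2' := integrable_scale (s + 1) I2.
have I12 := integrable_sub I1 I2'.
pose f x := gamma_integrand (s + 1) x - (s + 1) * gamma_integrand s x
            + K * expR (- (x / 2)).
have : (\int[mu]_(x in halfline) f x = 2 * K)%R.
  pose F x : R := - gamma_integrand (s + 1) x + - (2 * K * expR (- (x / 2))).
  have dF x : 0 < x -> is_derive x 1 F (f x).
    move=> x0; have -> : f x = - ((s + 1) * gamma_integrand (s + 1 - 1) x
        - gamma_integrand (s + 1) x) + K * expR (- (x / 2)).
      by rewrite addrK /f opprB.
    apply: (@is_deriveD _ _ _ (- gamma_integrand (s + 1))
      (fun x => - (2 * K * expR (- (x / 2))))).
      by apply: is_deriveN; exact: is_derive_gamma_integrand.
    exact: is_derive_Nhalf.
  rewrite (@Rintegral_ge0_continuous_FTC2y _ _ F _ 0)//.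
  - by rewrite /F /gamma_integrand powR0 ?mul0r ?oppr0 ?expR0; [lra|lra].
  - move=> x x0; rewrite /f /K.
    have := CP x x0; rewrite -(ler_pM2l (_ : 0 < s + 1)); last lra.
    have := gamma_integrand_ge0 (s + 1) x; lra.
  - have c1 : {within halfline, continuous (fun x : R => K * expR (- (x / 2)))}.
      apply: continuous_subspaceT => x; apply: cvgM; first exact: cvg_cst.
      exact: continuous_half.
    move=> x; apply: cvgD; last exact: c1.
    apply: cvgB; first exact: continuous_gamma_integrand.
    by apply: cvgM; [exact: cvg_cst|exact: continuous_gamma_integrand].
  - rewrite (_ : 0 = - 0 - 2 * K * 0 :> R); last by lra.
    apply: cvgB; first by apply: cvgN; exact: cvg_gamma_integrand.
    by apply: cvgM => //; exact: cvg_cst.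
  - by move=> x x0; case: (dF x x0).
  - apply: cvgD; first by apply: cvgN; exact: cvg0_gamma_integrand.
    apply: cvg_at_right_filter; apply: cvgN; apply: cvgM; first exact: cvg_cst.
    exact: continuous_half.
  - by move=> x; rewrite in_itv/= andbT derive1E => x0; case: (dF x x0).
rewrite /f RintegralD// RintegralB// RintegralZl// -!GammaE//.
rewrite [X in _ + X]/Rintegral integral_expR_half//=; lra.
Qed.

(** The right-hand side is convex in [x], and the left-hand side is its tangent
    at [c]; with [t = x / c] this is [1 - s (t - 1) <= expR (- s ln t)], which
    follows from [ln t <= t - 1]. *)
Lemma powRN_tangent (s x c : R) : 0 <= s -> 0 < x -> 0 < c ->
  c `^ (- s) * (1 + s - s * (x / c)) <= x `^ (- s).
Proof.
move=> s0 x0 c0.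
have -> : x `^ (- s) = c `^ (- s) * (x / c) `^ (- s).
  by rewrite -powRM ?divr_ge0// ?ltW//; congr (_ `^ _); field; lra.
rewrite ler_wpM2l ?powR_ge0//.
have t0 : 0 < x / c by rewrite divr_gt0.
rewrite /powR gt_eqF//.
apply: le_trans (expR_ge1Dx _).
have t1 : -1 < x / c - 1 by lra.
have := le_ln1Dx t1; rewrite [1 + _]addrC subrK => h.
by have := ler_wpM2l s0 h; lra.
Qed.

(** Integrate the tangent bound for [t^(-s)] at [c = x + 1 + s] against
    [t^(x+s) e^(-t)]. With this [c] the linear term has integral
    [Gamma (c + 1) / c = Gamma c], so that the terms in [s] cancel and
    [c^(-s) Gamma c <= Gamma (x + 1)] remains. *)
Lemma Gamma_shift_le s x : 0 <= s -> 0 < x ->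
  Gamma (x + 1 + s) <= (x + 1 + s) `^ s * Gamma (x + 1).
Proof.
move=> s0 x0.
have x0' := ltW x0.
have c0 : 0 < x + 1 + s by lra.
have xs : x + 1 + s = (x + s) + 1 by lra.
have xs0 : 0 < x + s by lra.
have xs0' := ltW xs0.
have xs1 : 0 <= x + s + 1 by lra.
have I1 := integrable_gamma_integrand xs0'.
have I2 := integrable_gamma_integrand xs1.
set c := x + 1 + s.
suff : c `^ (- s) * Gamma c <= Gamma (x + 1).
  rewrite powRN mulrC ler_pdivrMr ?powR_gt0// => /le_trans; apply.
  by rewrite mulrC.
have : c `^ (- s) * ((1 + s) * Gamma (x + s + 1)
    - s / c * Gamma (x + s + 1 + 1)) <= Gamma (x + 1).
  rewrite (GammaE x0') 2?GammaE// -RintegralZl// -RintegralZl//.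
  have J1 := integrable_scale (1 + s) I1.
  have J2 := integrable_scale (s / c) I2.
  have J3 := integrable_sub J1 J2.
  rewrite -RintegralB// -RintegralZl//.
  apply: le_Rintegral => //.
  - exact: (integrable_scale _ J3).
  - exact: integrable_gamma_integrand.
  - move=> y /=; rewrite in_itv/= andbT le_eqVlt => /predU1P[<-|y0].
      rewrite /gamma_integrand !powR0; lra.
    rewrite /gamma_integrand.
    have -> : y `^ (x + s + 1) = y `^ (x + s) * y.
      by rewrite powRD ?powRr1 ?(ltW y0)// (gt_eqF y0) implybT.
    have -> : y `^ x = y `^ (x + s) * y `^ (- s).
      by rewrite -powRD ?addrK// (gt_eqF y0) implybT.
    have h := powRN_tangent s0 y0 (c0 : 0 < c).
    have : 0 <= y `^ (x + s) * expR (- y).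
      by rewrite mulr_ge0 ?powR_ge0 ?expR_ge0.
    move=> /ler_wpM2l /(_ _ _ h) hy.
    rewrite [leLHS](_ : _ = y `^ (x + s) * expR (- y) *
      (c `^ (- s) * (1 + s - s * (y / c)))); last by ring.
    by rewrite (le_trans hy)// le_eqVlt; apply/orP; left; apply/eqP; ring.
rewrite Gamma_succ// -xs -/c.
rewrite (_ : (1 + s) * Gamma c - s / c * (c * Gamma c) = Gamma c)//.
by field; rewrite gt_eqF.
Qed.

End GammaIntegral.

(** * Generalised multiset coefficients and Euler's limit *)

Section Multichoose.
Context {R : realType}.
Implicit Types s x : R.

(** The number of multisets of size [n] over [x] letters, for real [x]. *)
Definition multichoose (x : R) n : R := \prod_(i < n) ((x + i%:R) / i.+1%:R).

Lemma multichoose0 x : multichoose x 0 = 1.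
Proof. by rewrite /multichoose big_ord0. Qed.

Lemma multichooseS x n :
  n.+1%:R * multichoose x n.+1 = (x + n%:R) * multichoose x n.
Proof.
rewrite /multichoose big_ord_recr/=; field.
by rewrite ?nat1r ?natr1 pnatr_eq0.
Qed.

Lemma multichoose1 n : multichoose 1 n = 1.
Proof.
apply: big1 => i _; by rewrite -natr1 addrC divff// natr1 pnatr_eq0.
Qed.

(** Vandermonde's identity, i.e. [(1-z)^(-x) (1-z)^(-y) = (1-z)^(-x-y)]. *)
Lemma multichooseD x y n :
  convol (multichoose x) (multichoose y) n = multichoose (x + y) n.
Proof.
rewrite /convol; elim: n => [|n IH].
  by rewrite big_ord1 !multichoose0 mulr1.
apply: (@mulfI _ n.+1%:R); first by rewrite pnatr_eq0.
rewrite multichooseS -IH.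
(* Split the factor [n + 1] as [k + (n + 1 - k)], and absorb each part into the
   factor with the matching index. *)
transitivity (
  \sum_(k < n.+2) (k%:R * multichoose x k * multichoose y (n.+1 - k)) +
  \sum_(k < n.+2)
    (multichoose x k * ((n.+1 - k)%:R * multichoose y (n.+1 - k)))).
  rewrite big_distrr -big_split/=; apply: eq_bigr => k _.
  by rewrite natrB ?leq_ord//; ring.
rewrite big_ord_recl/= !mul0r add0r.
rewrite [X in _ + X]big_ord_recr/= subnn mul0r mulr0 addr0.
rewrite -big_split big_distrr/=; apply: eq_bigr => k _.
rewrite /bump/= add1n subSS multichooseS subSn ?leq_ord// multichooseS.
rewrite natrB ?leq_ord//.
ring.
Qed.

Lemma psum_multichoose x n : psum (multichoose x) n = multichoose (x + 1) n.
Proof.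
by rewrite -multichooseD; apply: eq_bigr => k _; rewrite multichoose1 mulr1.
Qed.

Lemma multichoose_ge0 x n : 0 <= x -> 0 <= multichoose x n.
Proof. by move=> x0; apply: prodr_ge0 => i _; rewrite divr_ge0// addr_ge0. Qed.

Lemma Gamma_multichoose s n : 0 <= s ->
  Gamma (n%:R + s + 1) = n`!%:R * multichoose (s + 1) n * Gamma (s + 1).
Proof.
move=> s0; elim: n => [|n IH]; first by rewrite add0r multichoose0 !mul1r.
have -> : n.+1%:R + s + 1 = (n%:R + s + 1) + 1 by rewrite -natr1; lra.
rewrite Gamma_succ ?addr_ge0// IH factS mulnC natrM -[X in _ = X * _]mulrA.
by rewrite multichooseS; ring.
Qed.

Lemma Gamma_natS n : Gamma (n%:R + 1) = n`!%:R :> R.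
Proof.
have := @Gamma_multichoose 0 n (lexx _).
by rewrite addr0 add0r multichoose1 Gamma1 !mulr1.
Qed.

(** [Gamma_shift_le] bounds [Gamma (s + 1)] from below by a positive multiple
    of a factorial. *)
Lemma Gamma_gt0 s : 0 < s -> 0 < Gamma (s + 1).
Proof.
move=> s0; have [N sN] : exists N : nat, s <= N%:R.
  by exists (Num.truncn s).+1; exact/ltW/Num.Theory.truncnS_gt.
have h0 : 0 <= N%:R - s by lra.
have := Gamma_shift_le h0 s0.
rewrite (_ : s + 1 + (N%:R - s) = N%:R + 1); last by lra.
rewrite Gamma_natS => h.
have : 0 < (N%:R + 1) `^ (N%:R - s) * Gamma (s + 1).
  by apply: lt_le_trans h; rewrite ltr0n fact_gt0.
by rewrite pmulr_rgt0// powR_gt0// natr1 ltr0n.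
Qed.

Lemma cvg_powR_ratio (c t : R) : 0 <= c ->
  (fun n : nat => ((n%:R + c) / n%:R) `^ t) @ \oo --> (1 : R).
Proof.
move=> c0.
have h : (fun n : nat => (n%:R + c) / n%:R : R) @ \oo --> (1 : R).
  have h1 : (fun n : nat => 1 + c * n%:R^-1 : R) @ \oo --> (1 + c * 0 : R).
    apply: cvgD; first exact: cvg_cst.
    apply: cvgM; [exact: cvg_cst|].
    apply: (gtr0_cvgV0 (f := fun n : nat => n%:R : R) _).2;
      last exact: cvgr_idn.
    by near=> n; rewrite ltr0n; near: n; exact: nbhs_infty_gt.
  rewrite mulr0 addr0 in h1.
  apply: cvg_trans h1; apply: near_eq_cvg; near=> n.
  by rewrite mulrDl divff// pnatr_eq0 -lt0n; near: n; exact: nbhs_infty_gt.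
have c1 : {for (1 : R), continuous (fun x : R => x `^ t)}.
  apply: differentiable_continuous; apply/derivable1_diffP.
  by apply: derivable_powR; rewrite in_itv/= ltr01.
by have := cvg_comp _ _ h c1; rewrite powR1.
Unshelve. all: by end_near. Qed.

(** Euler's limit for the Gamma function. The upper bound is [Gamma_shift_le]
    with shift [s] from [n + 1]; the lower bound is the same inequality with
    shift [N - s] from [n + s + 1], for an integer [N >= s], together with
    [n^N n! <= (n + N)!]. *)
Lemma cvg_multichoose s : 0 < s ->
  (fun n : nat => multichoose (s + 1) n / n%:R `^ s) @ \oo -->
  (Gamma (s + 1))^-1.
Proof.
move=> s0; have s0' := ltW s0; have G0 := Gamma_gt0 s0.
have [N sN] : exists N : nat, s <= N%:R.
  by exists (Num.truncn s).+1; exact/ltW/Num.Theory.truncnS_gt.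
suff h : (fun n : nat => multichoose (s + 1) n * Gamma (s + 1) / n%:R `^ s)
    @ \oo --> (1 : R).
  rewrite -[X in _ --> X]mul1r.
  have h1 : (fun n : nat => multichoose (s + 1) n * Gamma (s + 1) / n%:R `^ s
     * (Gamma (s + 1))^-1) @ \oo --> 1 * (Gamma (s + 1))^-1.
    by apply: cvgM => //; exact: cvg_cst.
  apply: cvg_trans h1; apply: near_eq_cvg; near=> n.
  by rewrite mulrAC mulfK// gt_eqF.
apply: (@squeeze_cvgr _ _ _ _
  (fun n : nat => ((n%:R + N.+1%:R) / n%:R) `^ (s - N%:R))
  (fun n : nat => ((n%:R + (1 + s)) / n%:R) `^ s)).
- near=> n.
  have n0 : 0 < n%:R :> R by rewrite ltr0n; near: n; exact: nbhs_infty_gt.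
  have n0' := ltW n0.
  have f0 : 0 < n`!%:R :> R by rewrite ltr0n fact_gt0.
  have E :
      multichoose (s + 1) n * Gamma (s + 1) = Gamma (n%:R + s + 1) / n`!%:R.
    by rewrite Gamma_multichoose//; field; rewrite gt_eqF.
  have P0 : 0 < n%:R `^ s by exact: powR_gt0.
  rewrite E; apply/andP; split; last first.
    rewrite powRM ?invr_ge0 ?addr_ge0//.
    rewrite -[n%:R^-1]powR_inv1// -powRrM mulN1r powRN ler_pM2r ?invr_gt0//.
    rewrite ler_pdivrMr// -Gamma_natS.
    have := Gamma_shift_le s0' n0.
    by rewrite addrAC -addrA [s + 1]addrC.
  have Ns : 0 <= N%:R - s by lra.
  have ns0 : 0 < n%:R + s by lra.
  have := Gamma_shift_le Ns ns0.
  rewrite (_ : n%:R + s + 1 + (N%:R - s) = (n + N)%:R + 1); last first.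
    by rewrite natrD; lra.
  rewrite Gamma_natS natr1 -addnS natrD => h.
  set c := n%:R + N.+1%:R in h *.
  have c0 : 0 < c by rewrite addr_gt0// ltr0n.
  have C0 : 0 < c `^ (N%:R - s) by exact: powR_gt0.
  have -> : (c / n%:R) `^ (s - N%:R) = n%:R ^+ N / n%:R `^ s / c `^ (N%:R - s).
    rewrite -(opprB N%:R s) powRN powRM ?invr_ge0 ?(ltW c0)//.
    rewrite -[n%:R^-1]powR_inv1// -powRrM mulN1r powRN invfM invrK mulrC.
    by rewrite powRB ?powR_mulrn ?(gt_eqF n0) ?implybT.
  rewrite [leLHS]mulrAC ler_pM2r ?invr_gt0// ler_pdivrMr//.
  rewrite mulrAC ler_pdivlMr//.
  rewrite [leRHS]mulrC; apply: le_trans h.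
  rewrite -natrX -natrM ler_nat.
  elim: (N) => [|k IH]; first by rewrite expn0 mul1n addn0.
  rewrite addnS factS expnS -mulnA leq_mul//.
  by rewrite ltnW// ltnS leq_addr.
- by apply: cvg_powR_ratio.
- by apply: cvg_powR_ratio; lra.
Unshelve. all: by end_near. Qed.

End Multichoose.

(** * The limit for power weights *)

Section PowerWeights.
Context {R : realType}.
Implicit Types p q s : R.

Lemma cvg_powR_inv s : 0 < s -> ((n%:R : R) `^ s)^-1 @[n --> \oo] --> (0 : R).
Proof.
move=> s0; have s0' := ltW s0.
apply/cvgr0Pnorm_lt => eps eps0.
exists (Num.truncn (eps `^ (- s^-1))).+1 => // n /= hn.
have xn : eps `^ (- s^-1) < n%:R.
  by apply: lt_le_trans (Num.Theory.truncnS_gt _) _; rewrite ler_nat.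
have n0 : 0 < n%:R :> R by apply: le_lt_trans xn; exact: powR_ge0.
rewrite ger0_norm ?invr_ge0 ?powR_ge0// invf_plt ?posrE ?powR_gt0//.
have -> : eps^-1 = (eps `^ (- s^-1)) `^ s.
  by rewrite -powRrM mulNr mulVf ?gt_eqF// powR_inv1// ltW.
by rewrite gt0_ltr_powR ?nnegrE ?powR_ge0// ltW.
Qed.

Lemma growth_powR s : 0 < s -> growth (fun n => (n%:R : R) `^ s).
Proof.
move=> s0; split => [|n|n|]; first exact: powR_ge0.
- by rewrite powR_gt0 ?ltr0n.
- by rewrite ge0_ler_powR ?nnegrE ?ler0n ?ler_nat// ltW.
- exact: cvg_powR_inv.
Qed.

(** The comparison is read backwards: for [multichoose p] and
    [multichoose (q + 1)] the convolution is known, and this determines the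
    limit of the universal weight. *)
Lemma cvg_convol_powR p q : 0 < p -> 0 < q ->
  convol (increments (fun n => n%:R `^ q)) (fun n => n%:R `^ p) n
    / (n%:R `^ p * n%:R `^ q) @[n --> \oo]
  --> Gamma (p + 1) * Gamma (q + 1) / Gamma (p + q + 1).
Proof.
move=> p0 q0; have pq0 : 0 < p + q by exact: addr_gt0.
have Gp := Gamma_gt0 p0; have Gq := Gamma_gt0 q0; have Gpq := Gamma_gt0 pq0.
have cp : psum (multichoose p) n / n%:R `^ p @[n --> \oo] -->
    (Gamma (p + 1))^-1.
  by under eq_fun do rewrite psum_multichoose; exact: cvg_multichoose.
have [B HB] : exists B, forall n,
    psum (fun k => `|multichoose p k|) n.+1 <= B * n.+1%:R `^ p.
  have /cvg_seq_bounded[M [_ HM]] :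
      cvgn (fun n => psum (multichoose p) n / n%:R `^ p).
    by apply/cvg_ex; eexists; exact: cp.
  exists (M + 1) => n.
  have := HM (M + 1); rewrite ltrDl => /(_ ltr01 n.+1 I) /=.
  have P0 : 0 < n.+1%:R `^ p :> R by rewrite powR_gt0.
  move=> h; rewrite -ler_pdivrMr//; apply: le_trans h.
  apply: le_trans (ler_norm _); rewrite ler_pM2r ?invr_gt0//.
  by apply: ler_sum => k _; rewrite ger0_norm// multichoose_ge0// ltW.
have := cvg_convol_compare (growth_powR p0) (growth_powR q0) HB cp
  (cvg_multichoose q0).
set W := fun n : nat => convol (increments _) _ n / _.
move=> h.
pose X n := convol (multichoose p) (multichoose (q + 1)) n /
  (n%:R `^ p * n%:R `^ q).
have h2 : X n @[n --> \oo] --> (Gamma (p + q + 1))^-1.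
  have := cvg_multichoose pq0; apply: cvg_trans; apply: near_eq_cvg; near=> n.
  rewrite /X multichooseD addrA powRD//; apply/implyP => _.
  by rewrite pnatr_eq0 -lt0n; near: n; exact: nbhs_infty_gt.
(* Recover [g * W n] as [g * (X n - (X n - W n / g))], where [X n] comes
   from the explicit convolution. *)
pose g := Gamma (p + 1) * Gamma (q + 1).
have g0 : g != 0 by rewrite mulf_neq0 ?gt_eqF.
have h3 : g * (X n - (X n - (Gamma (q + 1))^-1 * (Gamma (p + 1))^-1 * W n))
    @[n --> \oo] --> g / Gamma (p + q + 1).
  rewrite -[Y in _ --> g * Y]subr0.
  by apply: cvgM; [exact: cvg_cst|apply: cvgB].
apply: cvg_trans h3; apply: near_eq_cvg; near=> n.
rewrite opprB addrC subrK -invfM [_ * Gamma (p + 1)]mulrC -/g mulrA.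
by rewrite divff// mul1r.
Unshelve. all: by end_near. Qed.

End PowerWeights.

(** * Complex sequences and sums over cubes *)

Section ComplexWeights.
Context {R : realType}.

Lemma normc_real (x : R) : `|x%:C| = `|x|%:C.
Proof. by rewrite normc_def/= expr0n addr0 sqrtr_sqr. Qed.

Lemma cvg_real_complex (f : nat -> R) (l : R) :
  f n @[n --> \oo] --> l -> (f n)%:C @[n --> \oo] --> (l%:C : R[i]^o).
Proof.
move=> /cvgrPdist_lt h.
apply/(@cvgrPdist_lt _ (R[i]^o : normedModType R[i])) => -[e e'].
rewrite ltcE/= => /andP[/eqP-> e0].
near=> n; rewrite -rmorphB normc_real ltcR.
by near: n; exact: h.
Unshelve. all: by end_near. Qed.

Lemma growth_complex (P : nat -> R) : growth P -> growth (fun n => (P n)%:C).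
Proof.
case=> P0 Pp Pm Pv; split => [|n|n|]; rewrite ?lecR ?ltcR//.
have := cvg_real_complex Pv; apply: cvg_trans; apply: near_eq_cvg; near=> n.
by rewrite fmorphV.
Unshelve. all: by end_near. Qed.

Lemma convol_complex (u v : nat -> R) n :
  convol (fun k => (u k)%:C) (fun k => (v k)%:C) n = (convol u v n)%:C.
Proof.
by rewrite /convol rmorph_sum; apply: eq_bigr => k _; rewrite rmorphM.
Qed.

Lemma increments_complex (u : nat -> R) :
  increments (fun k => (u k)%:C) = fun k => (increments u k)%:C.
Proof. by apply: funext => -[|n] //=; rewrite rmorphB. Qed.

End ComplexWeights.

(** The indices of the left-hand side are those of the right-hand side
    translated by [k] in every coordinate. *)
Lemma multisum_shift (V : nmodType) (m k n : nat)
    (a : {ffun 'I_m -> nat} -> V) :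
  (forall (x : {ffun 'I_m -> nat}) (h : nat),
     (forall i, 0 < x i)%N -> (0 < h)%N -> (forall i, h < x i)%N ->
     a [ffun i => (x i - h)%N] = a x) ->
  (0 < k <= n)%N -> multisum k.+1 n a = multisum 1 (n - k) a.
Proof.
move=> a_shift /andP[k0 kn]; rewrite /multisum.
pose up (g : {ffun 'I_m -> 'I_(n - k).+1}) : {ffun 'I_m -> 'I_n.+1} :=
  [ffun i => inord (g i + k)].
pose down (f : {ffun 'I_m -> 'I_n.+1}) : {ffun 'I_m -> 'I_(n - k).+1} :=
  [ffun i => inord (f i - k)].
have upE g i : up g i = (g i + k)%N :> nat.
  have gi := leq_ord (g i); rewrite ffunE inordK// ltnS.
  by rewrite -[leqRHS](subnK kn) leq_add2r.
have downE f i : down f i = (f i - k)%N :> nat.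
  by rewrite ffunE inordK// ltnS leq_sub2r// -ltnS ltn_ord.
rewrite (reindex_onto up down) => [|f /forallP fk]; last first.
  by apply/ffunP => i; apply: val_inj; rewrite /= upE downE subnK// ltnW.
apply: eq_big => [g|g /andP[/forallP gk _]].
  rewrite [X in _ && X](_ : _ = true) ?andbT; last first.
    by apply/eqP/ffunP => i; apply: val_inj; rewrite /= downE upE addnK.
  by apply: eq_forallb => i /=; rewrite upE -addn1 addnC leq_add2r.
pose x : {ffun 'I_m -> nat} := [ffun i => nat_of_ord (up g i)].
have xE i : x i = (g i + k)%N by rewrite ffunE upE.
have gt1 i : (k < x i)%N.
  by have := gk i; rewrite /= xE upE.
rewrite -/x -(a_shift x k) => [|i||]//; last exact: leq_ltn_trans (gt1 i).
by congr a; apply/ffunP => i; rewrite [LHS]ffunE [RHS]ffunE xE addnK.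
Qed.

Theorem proposition3p2 (R : realType) (p q : R) (m : nat)
    (b : nat -> R[i]) (b_lim : R[i]) (B : R)
    (a : {ffun 'I_m -> nat} -> R[i]) (a_lim : R[i])
    (p_gt0 : 0 < p) (q_gt0 : 0 < q) (m_gt0 : (0 < m)%N)
    (b_cvg : (fun n : nat =>
        ((n%:R `^ p)^-1)%:C * \sum_(1 <= k < n.+1) b k : R[i]^o) @ \oo
      --> (b_lim : R[i]^o))
    (b_bound : forall n : nat, (0 < n)%N ->
        ((n%:R `^ p)^-1)%:C * \sum_(1 <= k < n.+1) `|b k| <= B%:C)
    (a_cvg : (fun n : nat =>
        ((n%:R `^ q)^-1)%:C * multisum 1 n a : R[i]^o) @ \oo
      --> (a_lim : R[i]^o))
    (a_shift : forall (k : {ffun 'I_m -> nat}) (h : nat),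
        (forall i, 0 < k i)%N -> (0 < h)%N -> (forall i, h < k i)%N ->
        a [ffun i => (k i - h)%N] = a k) :
  (fun n : nat =>
      ((n%:R `^ (p + q))^-1)%:C *
      \sum_(1 <= k < n.+1) b k * multisum k.+1 n a : R[i]^o) @ \oo
    --> (a_lim * b_lim *
         (Gamma (p + 1) * Gamma (q + 1) / Gamma (p + q + 1))%:C : R[i]^o).
Proof.
pose P n : R[i] := (n%:R `^ p)%:C.
pose Q n : R[i] := (n%:R `^ q)%:C.
have gP : growth P := growth_complex (growth_powR p_gt0).
have gQ : growth Q := growth_complex (growth_powR q_gt0).
(* [convol] and [psum] start at 0, the sums of the statement at 1. *)
pose u k := if k is 0 then 0 else b k.
pose v n := multisum 1 n a.
have sum1 (F : nat -> R[i]) n :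
    \sum_(1 <= k < n.+1) F k = psum (fun k => if k is 0 then 0 else F k) n.
  rewrite /psum -(big_mkord xpredT (fun k => if k is 0 then 0 else F k)).
  by rewrite big_ltn// add0r; apply: eq_big_nat => -[].
have uB n : psum (fun k => `|u k|) n.+1 <= B%:C * P n.+1.
  have [_ P0 _ _] := gP.
  have := b_bound n.+1 isT; rewrite fmorphV mulrC (ler_pdivrMr _ _ (P0 n)).
  rewrite sum1; suff -> : psum (fun k => `|u k|) n.+1 =
      psum (fun k => if k is 0 then 0 else `|b k|) n.+1 by [].
  by apply: eq_bigr => -[[|k] hk] _ //=; rewrite normr0.
have ub : psum u n / P n @[n --> \oo] --> (b_lim : R[i]^o).
  apply: cvg_trans b_cvg; apply: near_eq_cvg; near=> j.
  by rewrite fmorphV mulrC sum1.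
have va : v n / Q n @[n --> \oo] --> (a_lim : R[i]^o).
  apply: cvg_trans a_cvg; apply: near_eq_cvg; near=> j.
  by rewrite fmorphV mulrC.
have W := cvg_real_complex (cvg_convol_powR p_gt0 q_gt0).
have WC : convol (increments Q) P n / (P n * Q n) @[n --> \oo] -->
    ((Gamma (p + 1) * Gamma (q + 1) / Gamma (p + q + 1))%:C : R[i]^o).
  apply: cvg_trans W; apply: near_eq_cvg; near=> j.
  by rewrite increments_complex convol_complex rmorphM fmorphV rmorphM.
apply: cvg_trans (cvg_convol gP gQ uB ub va WC).
apply: near_eq_cvg; near=> n.
have n0 : (0 < n)%N by near: n; exact: nbhs_infty_gt.
rewrite sum1 powRD; last by rewrite pnatr_eq0 -lt0n n0 implybT.
rewrite mulrC fmorphV rmorphM; congr (_ * _).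
apply: eq_bigr => -[[|k] hk] _ /=; first by rewrite mul0r.
by rewrite multisum_shift//= -ltnS.
Unshelve. all: by end_near. Qed.
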